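(* Let $K$ be a $b$-complete idempotent semiring, $X$ a nonempty set, and $V$ a nondegenerate functional $b$-subsemimodule of $K(X)$. The kernel theorem holds for $V$ if and only if there exists a semimetric $d$ on $X$ with values in $K$ such that $V$ is a $b$-subsemimodule of $\mathrm{lip}(X,d)$ and $V\supset \mathrm{lip}_0(X,d)$. In particular, if $V$ (with such a semimetric $d$) is a $b$-closed subsemimodule of $K(X)$, then $V=\mathrm{lip}(X,d)$.
   Context: An idempotent semigroup is a commutative semigroup $(S,\oplus)$ with $x\oplus x=x$ for all $x$. It carries the standard order $x\preceq y \iff x\oplus y=y$, so $x\oplus y=\sup\{x,y\}$; write $\oplus X=\sup X$ when it exists. ''Bounded'' means bounded from above. $S$ is $b$-complete if every bounded subset, including $\varnothing$, has a least upper bound; then $\mathbf 0=\oplus\varnothing$ is the zero (least) element. An idempotent semiring $K$ is an idempotent semigroup with an associative (not necessarily commutative) multiplication $\odot$ with identity $\mathbf 1$ and both distributive laws; it is $b$-complete if it is a $b$-complete semigroup and $k\odot(\oplus Q)=\oplus(k\odot Q)$, $(\oplus Q)\odot k=\oplus(Q\odot k)$ for all $k\in K$ and bounded $Q\subset K$. A (left, idempotent) semimodule $V$ over $K$ is an idempotent semigroup with zero $\mathbf 0$ and a multiplication $k\odot x$ ($k\in K$, $x\in V$) with $a\odot(b\odot x)=(a\odot b)\odot x$, $(a\oplus b)\odot x=a\odot x\oplus b\odot x$, $a\odot(x\oplus y)=a\odot x\oplus a\odot y$, $\mathbf 0\odot x=\mathbf 0$, $\mathbf 1\odot x=x$. $V$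 (over $b$-complete $K$) is $b$-complete if it is a $b$-complete semigroup and $k\odot\oplus S=\oplus(k\odot S)$, $(\oplus Q)\odot v=\oplus(Q\odot v)$ for all $k\in K$, $v\in V$ and bounded $S\subset V$, $Q\subset K$. A homomorphism $g:V\to W$ of $b$-complete semimodules (additive, $g(a\odot x)=a\odot g(x)$) is $b$-linear if $g(\oplus S)=\oplus g(S)$ for every bounded $S\subset V$. $K(X)$ is the semimodule of all functions $X\to K$ with pointwise operations. A $b$-subsemimodule $V$ of a $b$-complete semimodule $U$ is a subsemimodule (closed under addition and scalar multiplication) that is itself $b$-complete and whose inclusion into $U$ is $b$-linear, i.e. suprema in $V$ of subsets bounded in $V$ coincide with those in $U$. A subsemimodule $V$ of $U$ is $b$-closed if the sum (supremum in $U$) of every subset of $V$ that is bounded in $U$ lies in $V$. $V\subset K(X)$ is nondegenerate if for each $x\in X$ there is $g\in V$ with $g(x)=\mathbf 1$. The kernel theorem holds for $V$ if for every $b$-complete semimodule $W$ over $K$ and every $b$-linear mapping $A:V\to W$ there is a mapping $k:X\to W$ such that for every $f\in V$ the set $\{f(x)\odot k(x)\mid x\in X\}$ is bounded in $W$ and $Af=\bigoplus_{x\in X}f(x)\odot k(x)$. A semimetric on $X$ with values in $K$ is a function $d:X\times X\to K$ with $d(x,y)=\bigoplus_{z\in X}d(x,z)\odot d(z,y)$ for all $x,y\in X$ (the set of summands being bounded). Define $\mathrm{lip}(X,d)=\{f\in K(X)\mid f(x)=\bigoplus_{y\in X}f(y)\odot d(y,x)\ \text{for all }x\in X\}$, a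 $b$-closed subsemimodule of $K(X)$. For $x\in X$ put $d_x:y\mapsto d(x,y)$; each $d_x\in\mathrm{lip}(X,d)$, and $\mathrm{lip}_0(X,d)$ is the subsemimodule of $\mathrm{lip}(X,d)$ consisting of all finite linear combinations of the functions $d_x$, $x\in X$. *)

(* Defs.v *)
From HB Require Import structures.
From mathcomp Require Import all_boot ssralg.
From mathcomp Require Import boolp classical_sets functions.

Set Implicit Arguments.
Unset Strict Implicit.
Unset Printing Implicit Defensive.

Import GRing.Theory.

Local Open Scope classical_set_scope.
Local Open Scope ring_scope.

(* Additions and multiplications are those of the MathComp structures:
   (S, (+)) is an nmodType, K a pzSemiRingType (which need not be commutative,
   and 1 = 0 is allowed), a left semimodule over K an lSemiModType K.  The zero
   of a b-complete semiring and its absorption law come for free, as the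
   supremum of the empty set and the b-completeness laws for Q empty.
   Idempotency of + is imposed by b_complete below.

   Every notion concerning a semigroup or semimodule is stated for a subset V
   of an ambient type E, with the operations and order inherited from E;
   V = setT is the case of the whole of E. *)

Section Semigroup.
Variable E : nmodType.
Implicit Types (V S : set E) (x y s : E).

Definition std_le x y := x + y = y.

Definition is_ub S s := forall x, S x -> std_le x s.

Definition bounded_in V S := exists2 b, V b & is_ub S b.

(* s = (+) S, the supremum being taken in V; this entails that S is
   bounded in V. *)
Definition is_sup_in V S s :=
  [/\ V s, is_ub S s & forall b, V b -> is_ub S b -> std_le s b].

(* S = set0 is allowed. *)
Definition b_complete V :=
  {in V, forall x, x + x = x} /\
  forall S, S `<=` V -> bounded_in V S -> exists s, is_sup_in V S s.

End Semigroup.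

Definition is_sup (E : nmodType) (S : set E) (s : E) := is_sup_in setT S s.

Definition b_complete_semiring (K : pzSemiRingType) :=
  [/\ b_complete [set: K],
      forall (k : K) (Q : set K) (q : K), bounded_in setT Q -> is_sup Q q ->
        is_sup [set k * x | x in Q] (k * q) &
      forall (k : K) (Q : set K) (q : K), bounded_in setT Q -> is_sup Q q ->
        is_sup [set x * k | x in Q] (q * k)].

Section Semimodule.
Variable K : pzSemiRingType.

Definition subsemimodule (U : lSemiModType K) (V : set U) :=
  GRing.subsemimod_closed [in V].

Definition b_complete_semimodule (U : lSemiModType K) (V : set U) :=
  [/\ subsemimodule V, b_complete V,
      forall (k : K) (S : set U) (s : U),
        S `<=` V -> bounded_in V S -> is_sup_in V S s ->
        is_sup_in V [set k *: x | x in S] (k *: s) &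
      forall (v : U) (Q : set K) (q : K),
        V v -> bounded_in setT Q -> is_sup Q q ->
        is_sup_in V [set x *: v | x in Q] (q *: v)].

(* A is a b-linear mapping V -> T; the values of A outside V are irrelevant. *)
Definition b_linear (U W : lSemiModType K) (V : set U) (T : set W)
    (A : U -> W) :=
  [/\ {homo A : x / V x >-> T x},
      {in V &, {morph A : x y / x + y}},
      forall a : K, {in V, {morph A : x / a *: x}} &
      forall (S : set U) (s : U),
        S `<=` V -> bounded_in V S -> is_sup_in V S s ->
        is_sup_in T [set A x | x in S] (A s)].

Definition b_subsemimodule (U : lSemiModType K) (V T : set U) :=
  [/\ V `<=` T, b_complete_semimodule V & b_linear V T id].

Definition b_closed_subsemimodule (U : lSemiModType K) (V : set U) :=
  subsemimodule V /\
  forall (S : set U) (s : U),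
    S `<=` V -> bounded_in setT S -> is_sup S s -> V s.

End Semimodule.

(* K(X). An alias of X -> K, because the scaling on function types provided by
   the library requires the scalars to form a ring. *)
Definition funs (X : Type) (K : pzSemiRingType) : Type := X -> K.

Section FunsSemimodule.
Variables (X : Type) (K : pzSemiRingType).

HB.instance Definition _ := GRing.Nmodule.copy (funs X K) (X -> K).

Definition funs_scale (k : K) (f : funs X K) : funs X K := fun x => k * f x.

Fact funs_scalerA a b f : funs_scale a (funs_scale b f) = funs_scale (a * b) f.
Proof. by apply/funext => x; rewrite /funs_scale mulrA. Qed.

Fact funs_scale0r f : funs_scale 0 f = 0.
Proof. by apply/funext => x; rewrite /funs_scale mul0r. Qed.

Fact funs_scale1r : left_id 1 funs_scale.
Proof. by move=> f; apply/funext => x; rewrite /funs_scale mul1r. Qed.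

Fact funs_scalerDr : right_distributive funs_scale +%R.
Proof. by move=> k f g; apply/funext => x; rewrite /funs_scale mulrDr. Qed.

Fact funs_scalerDl f : {morph funs_scale^~ f : a b / a + b}.
Proof. by move=> a b; apply/funext => x; rewrite /funs_scale mulrDl. Qed.

HB.instance Definition _ :=
  GRing.Nmodule_isLSemiModule.Build K (funs X K)
    funs_scalerA funs_scale0r funs_scale1r funs_scalerDr funs_scalerDl.

End FunsSemimodule.

Section Kernel.
Variables (X : Type) (K : pzSemiRingType).
Implicit Types (V : set (funs X K)) (d : X -> X -> K).

Definition nondegenerate_funs V := forall x, exists2 g, V g & g x = 1.

Definition kernel_theorem V :=
  forall (W : lSemiModType K), b_complete_semimodule [set: W] ->
  forall A : funs X K -> W, b_linear V setT A ->
  exists k : X -> W, forall f, V f ->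
    is_sup [set f x *: k x | x in [set: X]] (A f).

Definition semimetric d :=
  forall x y, is_sup [set d x z * d z y | z in [set: X]] (d x y).

Definition lip d : set (funs X K) :=
  [set f : funs X K |
    forall x, is_sup [set f y * d y x | y in [set: X]] (f x)].

Definition lip0 d : set (funs X K) :=
  [set f : funs X K | exists s : seq (K * X),
    f = \sum_(p <- s) p.1 *: (d p.2 : funs X K)].

End Kernel.

(* Main.v *)
(* The kernel of the identity V -> V is d: the identity f = (+)_x f(x) d_x is
   membership in lip(X,d), and for f = d_x it is the semimetric equation.
   Conversely, this identity, read as a supremum taken in V, is mapped by a
   b-linear A to A f = (+)_x f(x) (A d_x), so x |-> A d_x is a kernel of A. *)

From HB Require Import structures.
Require Import Defs.
From mathcomp Require Import all_boot ssralg.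
From mathcomp Require Import boolp classical_sets functions.

Set Implicit Arguments.
Unset Strict Implicit.

Local Open Scope classical_set_scope.
Local Open Scope ring_scope.

Import GRing.Theory.

(** A smaller set offers fewer competing upper bounds, so a supremum that already lies in it remains
    least. *)
Lemma is_sup_in_sub (E : nmodType) (V T S : set E) (s : E) :
  V `<=` T -> V s -> is_sup_in T S s -> is_sup_in V S s.
Proof. by move=> VT Vs [_ ubs lub]; split=> // b /VT; apply: lub. Qed.

(** Suprema in [V] are suprema in all of [U], hence in any set between the two; applied below with
    [T] equal to [lip d]. *)
Lemma b_subsemimodule_sub (K : pzSemiRingType) (U : lSemiModType K)
    (V T : set U) :
  V `<=` T -> b_subsemimodule V setT -> b_subsemimodule V T.
Proof.
move=> VT [_ bV [_ addV scaleV supV]]; split=> //; split=> // S s SV bS sS.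
have [Vs _ _] := sS.
by apply: is_sup_in_sub (VT _ Vs) (supV _ _ SV bS sS); apply: subsetT.
Qed.

Section SubsemimoduleType.
Variables (K : pzSemiRingType) (U : lSemiModType K) (V : set U).

(* V as a type: the target W of a kernel theorem is a whole type. *)
Record subsemimod_type (hV : subsemimodule V) :=
  Subsemimod { subsemimod_val : U; _ : subsemimod_val \in V }.

Variable hV : subsemimodule V.

HB.instance Definition _ := [isSub for @subsemimod_val hV].
HB.instance Definition _ := [Choice of subsemimod_type hV by <:].
HB.instance Definition _ :=
  GRing.SubChoice_isSubLSemiModule.Build K U [in V] (subsemimod_type hV) hV.

Local Notation W := (subsemimod_type hV).

Lemma subsemimod_valP (w : W) : V (val w).
Proof. exact/set_mem/(valP w). Qed.

Lemma val_insubd (u : U) : V u -> val (insubd (0 : W) u) = u.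
Proof. by move=> Vu; rewrite insubdK //; apply/mem_set. Qed.

Lemma val_scale (a : K) (w : W) : val (a *: w) = a *: val w.
Proof. exact: linearZ. Qed.

Lemma std_le_val (v w : W) : std_le (val v) (val w) <-> std_le v w.
Proof. by rewrite /std_le -raddfD; split=> [/val_inj|->]. Qed.

Lemma is_ub_val (S : set W) (w : W) :
  is_ub [set val x | x in S] (val w) <-> is_ub S w.
Proof.
split=> [ubw x Sx|ubw _ [x Sx <-]]; apply/std_le_val; last exact: ubw.
by apply: ubw; exists x.
Qed.

(** [val] is an order isomorphism from [W] onto [V], so the matching suprema are those taken in [V],
    not in [U]. *)
Lemma is_sup_val (S : set W) (w : W) :
  is_sup_in V [set val x | x in S] (val w) <-> is_sup S w.
Proof.
split=> [[_ ubw lub]|[_ ubw lub]]; split.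
- by [].
- exact/is_ub_val.
- move=> b _ /is_ub_val ubb; apply/std_le_val/lub => //.
  exact: subsemimod_valP.
- exact: subsemimod_valP.
- exact/is_ub_val.
- move=> b Vb; rewrite -(val_insubd Vb) => /is_ub_val ubb.
  exact/std_le_val/lub.
Qed.

Lemma bounded_in_val (S : set W) :
  bounded_in setT S -> bounded_in V [set val x | x in S].
Proof.
by move=> [b _ /is_ub_val ubb]; exists (val b) => //; apply: subsemimod_valP.
Qed.

Lemma val_image_sub (S : set W) : [set val x | x in S] `<=` V.
Proof. by move=> _ [x _ <-]; apply: subsemimod_valP. Qed.

(** Makes [W] an admissible target in [kernel_theorem]; the supremum laws of [V] are carried over by
    [is_sup_val]. *)
Lemma subsemimod_type_b_complete :
  b_complete_semimodule V -> b_complete_semimodule [set: W].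
Proof.
case=> _ [idemV supV] scaleS scaleQ; split.
- by split=> [|a v _]; [split=> [|u v _ _]|]; apply/mem_set.
- split=> [x _|S _ bS].
    by apply/val_inj; rewrite raddfD idemV //; apply: valP.
  have [s ss] := supV _ (@val_image_sub S) (bounded_in_val bS).
  have [Vs _ _] := ss; exists (insubd 0 s); apply/is_sup_val.
  by rewrite val_insubd.
- move=> k S s _ bS /is_sup_val ss; apply/is_sup_val.
  have := scaleS k _ _ (@val_image_sub S) (bounded_in_val bS) ss.
  by rewrite val_scale !image_comp; congr is_sup_in; apply: eq_imagel => x _;
    apply: val_scale.
- move=> v Q q _ bQ qQ; apply/is_sup_val.
  have := scaleQ _ _ _ (subsemimod_valP v) bQ qQ.
  by rewrite val_scale image_comp; congr is_sup_in; apply: eq_imagel => x _;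
    apply: val_scale.
Qed.

(** This map is the identity of [V] with its target turned into a type; the default [0] is taken
    only outside [V]. *)
Lemma insubd_b_linear : b_linear V [set: W] (insubd (0 : W)).
Proof.
have [[_ VD] VZ] := hV; split=> //.
- move=> x y Vx Vy; apply/val_inj.
  by rewrite raddfD /= !val_insubd //; apply/set_mem => //; apply: VD.
- move=> a x Vx; apply/val_inj.
  by rewrite val_scale !val_insubd //; apply/set_mem => //; apply: VZ.
- move=> S s SV _ sS; have [Vs _ _] := sS; apply/is_sup_val.
  rewrite image_comp val_insubd //; congr (is_sup_in V _ s): sS.
  rewrite -[LHS]image_id; apply: eq_imagel => x /SV Vx /=.
  by rewrite val_insubd.
Qed.
End SubsemimoduleType.

Section Functions.
Variables (X : Type) (K : pzSemiRingType).
Implicit Types (V : set (funs X K)) (d : X -> X -> K).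

Lemma std_le_funs (f g : funs X K) :
  std_le f g <-> forall x, std_le (f x) (g x).
Proof.
split=> [fg x|fg]; first by rewrite /std_le -[in RHS]fg.
by apply/funext => x; apply: fg.
Qed.

Lemma is_sup_funs (S : set (funs X K)) (f : funs X K) :
  is_sup S f <-> forall x, is_sup [set g x | g in S] (f x).
Proof.
split=> [[_ ubf lub] x|sf]; split=> //.
- by move=> _ [g Sg <-]; exact: ((std_le_funs g f).1 (ubf g Sg) x).
- move=> b _ ubb.
  (* Replacing the value of [f] by [b] at the single point [x] leaves an upper bound of [S], so
     leastness of [f] can be read off at [x]. *)
  pose fb : funs X K := fun y => if `[< y = x >] then b else f y.
  have /std_le_funs/(_ x) : std_le f fb.
    apply: lub => // g Sg; apply/std_le_funs => y; rewrite /fb.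
    case: asboolP => [->|_]; first by apply: ubb; exists g.
    exact: ((std_le_funs g f).1 (ubf g Sg) y).
  by rewrite /fb asboolT.
- move=> g Sg; apply/std_le_funs => x; have [_ ubf _] := sf x.
  by apply: ubf; exists g.
- move=> b _ ubb; apply/std_le_funs => x; have [_ _ lub] := sf x.
  apply: lub => // _ [g Sg <-].
  exact: ((std_le_funs g b).1 (ubb g Sg) x).
Qed.

(** Suprema of functions are pointwise, so the equations defining [lip d] say that [f] is the sum of
    the multiples [f x *: d x] of the rows of [d], a form to which b-linear maps apply. *)
Lemma lipP d (f : funs X K) :
  lip d f <-> is_sup [set f x *: (d x : funs X K) | x in setT] f.
Proof.
by split=> [lf|/is_sup_funs sf]; [apply/is_sup_funs|] => x;
  [rewrite image_comp; apply: lf|have := sf x; rewrite image_comp].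
Qed.

Lemma lip0_row d x : lip0 d (d x).
Proof. by exists [:: (1, x)]; rewrite big_seq1 scale1r. Qed.

Lemma lip0_sub V d :
  subsemimodule V -> (forall x, V (d x)) -> lip0 d `<=` V.
Proof.
case=> -[V0 VD] VZ Vd _ [s ->]; apply: set_mem.
by apply: (big_ind (fun f => f \in V)) => // p _; apply/VZ/mem_set.
Qed.

Lemma semimetric_of_kernel_theorem V :
  b_subsemimodule V setT -> kernel_theorem V ->
  exists d, [/\ semimetric d, b_subsemimodule V (lip d) & lip0 d `<=` V].
Proof.
move=> hV kerV; have [_ bV [_ _ _ supV]] := hV; have [subV _ _ _] := bV.
have [k kP] :=
  kerV _ (subsemimod_type_b_complete subV bV) _ (insubd_b_linear subV).
pose d x : funs X K := val (k x).
have Vd x : V (d x) := subsemimod_valP (k x).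
have Vlip : V `<=` lip d.
  move=> f Vf; have sf := kP f Vf; have [_ ubf _] := sf; apply/lipP.
  have -> : [set f x *: d x | x in setT] =
      [set val w | w in [set f x *: k x | x in setT]].
    by rewrite image_comp; apply: eq_imagel => x _; apply/esym/val_scale.
  (* The kernel represents [f] as a supremum in [V] only; b-linearity of the inclusion makes it a
     supremum in [K(X)]. *)
  rewrite -[f in is_sup _ f](val_insubd subV Vf) -[X in is_sup X]image_id.
  apply: supV; first exact: val_image_sub; last exact/is_sup_val.
  by apply: bounded_in_val; exists (insubd 0 f).
exists d; split; last exact: lip0_sub.
  by move=> x y; apply: (Vlip _ (Vd x)).
exact: b_subsemimodule_sub.
Qed.

Lemma kernel_theorem_of_semimetric V d :
  subsemimodule V -> V `<=` lip d -> lip0 d `<=` V -> kernel_theorem V.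
Proof.
move=> [_ VZ] Vlip lip0V W _ A [_ _ scaleA supA].
have Vd x : V (d x) := lip0V _ (lip0_row d x).
exists (fun x => A (d x)) => f Vf.
have [_ ubf _] := (lipP d f).1 (Vlip f Vf).
have -> : [set f x *: A (d x) | x in setT] =
    [set A g | g in [set f x *: (d x : funs X K) | x in setT]].
  rewrite image_comp; apply: eq_imagel => x _ /=.
  by rewrite scaleA //; apply/mem_set.
(* The supremum has to be taken in [V], the domain of [A]: the terms are multiples of rows, hence in
   [V], and [f] in [V] is both a bound and the least one. *)
apply: supA.
- by move=> _ [x _ <-]; apply/set_mem/VZ/mem_set.
- by exists f.
- by apply: is_sup_in_sub Vf ((lipP d f).1 (Vlip f Vf)); apply: subsetT.
Qed.

(** By [lipP], a function in [lip d] is the supremum of multiples of rows of [d]; these lie in [V]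
    and are bounded by the function itself, so closedness applies. *)
Lemma lip_sub_b_closed V d :
  b_closed_subsemimodule V -> lip0 d `<=` V -> lip d `<=` V.
Proof.
move=> [[_ VZ] closedV] lip0V f /lipP sf; apply: (closedV _ _ _ _ sf).
  by move=> _ [x _ <-]; apply/set_mem/VZ/mem_set/lip0V/lip0_row.
by have [_ ubf _] := sf; exists f.
Qed.

End Functions.

Theorem theorem4 (K : pzSemiRingType) (hK : b_complete_semiring K)
    (X : Type) (hX : inhabited X) (V : set (funs X K))
    (hV : b_subsemimodule V [set: funs X K]) (hV1 : nondegenerate_funs V) :
  (kernel_theorem V <->
     exists d : X -> X -> K,
       [/\ semimetric d, b_subsemimodule V (lip d) & lip0 d `<=` V]) /\
  (forall d : X -> X -> K,
     semimetric d -> b_subsemimodule V (lip d) -> lip0 d `<=` V ->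
     b_closed_subsemimodule V -> V = lip d).
Proof.
split; first split.
- exact: semimetric_of_kernel_theorem.
- move=> [d [_ [Vlip [subV _ _ _] _] lip0V]].
  exact: kernel_theorem_of_semimetric Vlip lip0V.
- move=> d _ [Vlip _ _] lip0V closedV.
  by apply/seteqP; split=> //; apply: lip_sub_b_closed.
Qed.
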